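(* Given $a,b\in\mathbb{R}$, let $V=aX_1+bX_2$ be an element of the horizontal layer $V_1=\mathrm{span}\{X_1,X_2\}$ of the Engel group. Then $V$ is pliable if and only if either $a\neq0$ or $a=b=0$.
   Context: The Engel group $\mathbb{E}$ is the connected, simply connected Lie group whose Lie algebra is $V_1\oplus V_2\oplus V_3$ with $V_1=\mathrm{span}\{X_1,X_2\}$, $V_2=\mathrm{span}\{X_3\}$, $V_3=\mathrm{span}\{X_4\}$ (of dimension 4) and only non-zero brackets of basis vectors $[X_1,X_2]=X_3$, $[X_1,X_3]=X_4$ (up to antisymmetry). It is identified with $\mathbb{R}^4$ by exponential coordinates of the second kind, $(x_1,x_2,x_3,x_4)\leftrightarrow\exp(x_4X_4)\exp(x_3X_3)\exp(x_2X_2)\exp(x_1X_1)$, in which the horizontal left invariant vector fields are $X_1(x)=\partial_1$ and $X_2(x)=\partial_2+x_1\partial_3+\tfrac12x_1^2\partial_4$. Let $\|\cdot\|$ be the inner product norm on $V_1$ making $X_1,X_2$ orthonormal. An absolutely continuous curve $\gamma:[\alpha,\beta]\to\mathbb{E}$ is horizontal if for almost every $t$, $\dot\gamma(t)=u_1(t)X_1(\gamma(t))+u_2(t)X_2(\gamma(t))$ with $u=(u_1,u_2)\in L^1$; its length is $\int_\alpha^\beta|u|$, and one writes $\gamma'(t):=u_1(t)X_1+u_2(t)X_2\in V_1$. The Carnot-Carathéodory distance $d(x,y)$ is the infimum of the lengths of horizontal curves joining $x$ to $y$. $C^1_H([\alpha,\beta],\mathbb{E})$ is the set of continuously differentiable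 horizontal curves $\gamma:[\alpha,\beta]\to\mathbb{E}$, with the metric $\max\left(\sup_{t} d(\gamma_1(t),\gamma_2(t)),\ \sup_{t}\|\gamma_2'(t)-\gamma_1'(t)\|\right)$. A curve $\gamma\in C^1_H([\alpha,\beta],\mathbb{E})$ is pliable if for every neighborhood $\mathcal{V}$ of $\gamma$ in $C^1_H([\alpha,\beta],\mathbb{E})$ the set $\{(\sigma(\beta),\sigma'(\beta)):\sigma\in\mathcal{V},\ (\sigma(\alpha),\sigma'(\alpha))=(\gamma(\alpha),\gamma'(\alpha))\}$ is a neighborhood of $(\gamma(\beta),\gamma'(\beta))$ in $\mathbb{E}\times V_1$. A vector $V\in V_1$ is pliable if the curve $t\mapsto\exp(tV)$, $t\in[0,1]$, is pliable. *)

(* Defs.v *)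
From HB Require Import structures.
From mathcomp Require Import all_boot all_order all_algebra.
From mathcomp Require Import all_classical all_reals all_analysis.
From mathcomp Require Import ring.

Set Implicit Arguments.
Unset Strict Implicit.
Unset Printing Implicit Defensive.

Import Order.TTheory GRing.Theory Num.Theory.
Import numFieldNormedType.Exports.

Local Open Scope classical_set_scope.
Local Open Scope ring_scope.

(* The coordinates x_1, ..., x_4 of a point are the entries 0, ..., 3 of a
   row vector. *)
Definition row2 (R : realType) (a b : R) : 'rV[R]_2 :=
  \row_(i < 2) [:: a; b]`_i.
Definition row4 (R : realType) (a b c d : R) : 'rV[R]_4 :=
  \row_(i < 4) [:: a; b; c; d]`_i.

(* The Lie algebra, in the basis (X_1, X_2, X_3, X_4). *)
Definition engel_alg (R : realType) := 'rV[R]_4.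

Definition engel_bracket (R : realType) (v w : engel_alg R) : engel_alg R :=
  row4 0 0 (v 0 0 * w 0 1 - v 0 1 * w 0 0) (v 0 0 * w 0 2 - v 0 2 * w 0 0).

(* The horizontal layer V_1, in the basis (X_1, X_2). *)
Definition hlayer (R : realType) := 'rV[R]_2.

Definition X1 (R : realType) : hlayer R := row2 1 0.
Definition X2 (R : realType) : hlayer R := row2 0 1.

Definition hlayer_incl (R : realType) (v : hlayer R) : engel_alg R :=
  row4 (v 0 0) (v 0 1) 0 0.

(* The norm on V_1 for which (X_1, X_2) is orthonormal; the library norm on
   'rV[R]_2 is the sup norm. *)
Definition hnorm (R : realType) (v : hlayer R) : R :=
  Num.sqrt (v 0 0 ^+ 2 + v 0 1 ^+ 2).

(* The Engel group in exponential coordinates of the second kind; that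
   engel_mul and engel_exp are its product and exponential map is the content
   of engel_BCH and engel_exp_second_kind. *)
Definition engel (R : realType) := 'rV[R]_4.

Definition engel_mul (R : realType) (x y : engel R) : engel R :=
  row4 (x 0 0 + y 0 0)
       (x 0 1 + y 0 1)
       (x 0 2 + y 0 2 + x 0 0 * y 0 1)
       (x 0 3 + y 0 3 + x 0 0 * y 0 2 + x 0 0 ^+ 2 / 2 * y 0 1).

Definition engel_exp (R : realType) (v : engel_alg R) : engel R :=
  row4 (v 0 0)
       (v 0 1)
       (v 0 2 + v 0 0 * v 0 1 / 2)
       (v 0 3 + v 0 0 * v 0 2 / 2 + v 0 0 ^+ 2 * v 0 1 / 6).

(* v_1 X_1(x) + v_2 X_2(x) for the left-invariant fields X_1(x) = d_1 and
   X_2(x) = d_2 + x_1 d_3 + x_1^2/2 d_4. *)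
Definition hfield (R : realType) (v : hlayer R) (x : engel R) : 'rV[R]_4 :=
  v 0 0 *: row4 1 0 0 0 + v 0 1 *: row4 0 1 (x 0 0) (x 0 0 ^+ 2 / 2).

Lemma row4E (R : realType) (a b c d : R) :
  (row4 a b c d 0 0 = a) * (row4 a b c d 0 1 = b) *
  (row4 a b c d 0 2 = c) * (row4 a b c d 0 3 = d).
Proof. by do !split; rewrite mxE. Qed.

Lemma row4P (R : realType) (x y : 'rV[R]_4) :
  x 0 0 = y 0 0 -> x 0 1 = y 0 1 -> x 0 2 = y 0 2 -> x 0 3 = y 0 3 -> x = y.
Proof.
move=> h0 h1 h2 h3; apply/rowP => -[[|[|[|[|//]]]] hi].
- by rewrite (_ : Ordinal hi = 0) //; exact: val_inj.
- by rewrite (_ : Ordinal hi = 1) //; exact: val_inj.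
- by rewrite (_ : Ordinal hi = 2) //; exact: val_inj.
- by rewrite (_ : Ordinal hi = 3) //; exact: val_inj.
Qed.

Lemma engel_mulA (R : realType) (x y z : engel R) :
  engel_mul x (engel_mul y z) = engel_mul (engel_mul x y) z.
Proof. by rewrite /engel_mul !row4E; congr row4; field. Qed.

(* The Baker-Campbell-Hausdorff formula in step 3. *)
Lemma engel_BCH (R : realType) (v w : engel_alg R) :
  engel_mul (engel_exp v) (engel_exp w) =
  engel_exp (v + w + 2^-1 *: engel_bracket v w
             + 12^-1 *: engel_bracket v (engel_bracket v w)
             + 12^-1 *: engel_bracket w (engel_bracket w v)).
Proof.
have addE (x y : 'rV[R]_4) i : (x + y) 0 i = x 0 i + y 0 i by rewrite mxE.
have scaleE k (x : 'rV[R]_4) i : (k *: x) 0 i = k * x 0 i by rewrite mxE.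
rewrite /engel_mul /engel_exp /engel_bracket.
by rewrite !(row4E, addE, scaleE); congr row4; field.
Qed.

Lemma engel_exp_second_kind (R : realType) (x : engel R) :
  x = engel_mul (engel_exp (row4 0 0 0 (x 0 3)))
     (engel_mul (engel_exp (row4 0 0 (x 0 2) 0))
     (engel_mul (engel_exp (row4 0 (x 0 1) 0 0))
                (engel_exp (row4 (x 0 0) 0 0 0)))).
Proof.
have h (a b c d : R) : row4 a b c d =
    engel_mul (engel_exp (row4 0 0 0 d)) (engel_mul (engel_exp (row4 0 0 c 0))
    (engel_mul (engel_exp (row4 0 b 0 0)) (engel_exp (row4 a 0 0 0)))).
  by rewrite /engel_exp !row4E /engel_mul !row4E; congr row4; field.
rewrite -h.
by apply: row4P; rewrite row4E.
Qed.

(* The curves t |-> x exp(tV) are the integral curves of the field hfield V;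
   t = 0 says that this field is left-invariant with value V at the origin. *)
Lemma engel_exp_integral_curve (R : realType) (v : hlayer R) (x : engel R)
    (t : R) :
  let c := fun s : R => engel_mul x (engel_exp (s *: hlayer_incl v)) in
  is_derive t 1 (c : R -> 'rV[R]_4) (hfield v (c t)).
Proof.
move=> c.
have scaleE k (y : 'rV[R]_4) i : (k *: y) 0 i = k * y 0 i by rewrite mxE.
have addE (y z : 'rV[R]_4) i : (y + z) 0 i = y 0 i + z 0 i by rewrite mxE.
have cE s : c s = row4
    (x 0 0 + s * v 0 0) (x 0 1 + s * v 0 1)
    (x 0 2 + s * (x 0 0 * v 0 1) + s ^+ 2 * (v 0 0 * v 0 1 / 2))
    (x 0 3 + s * (x 0 0 ^+ 2 / 2 * v 0 1)
     + s ^+ 2 * (x 0 0 * v 0 0 * v 0 1 / 2)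
     + s ^+ 3 * (v 0 0 ^+ 2 * v 0 1 / 6)).
  rewrite /c /engel_exp /hlayer_incl !(scaleE, row4E) /engel_mul !row4E.
  by congr row4; field.
have hE : hfield v (c t) = row4 (v 0 0) (v 0 1)
    (x 0 0 * v 0 1 + 2 * t * (v 0 0 * v 0 1 / 2))
    (x 0 0 ^+ 2 / 2 * v 0 1 + 2 * t * (x 0 0 * v 0 0 * v 0 1 / 2)
     + 3 * t ^+ 2 * (v 0 0 ^+ 2 * v 0 1 / 6)).
  by rewrite /hfield cE row4E; apply: row4P; rewrite !(addE, scaleE, row4E);
    field.
have cP (k0 k1 k2 k3 : R) :
    is_derive t 1 (fun s : R => k0 + s * k1 + s ^+ 2 * k2 + s ^+ 3 * k3)
      (k1 + 2 * t * k2 + 3 * t ^+ 2 * k3).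
  pose p : {poly R} := k0%:P + k1 *: 'X + k2 *: 'X^2 + k3 *: 'X^3.
  have pE : horner p = (fun s => k0 + s * k1 + s ^+ 2 * k2 + s ^+ 3 * k3).
    by apply/funext => s; rewrite !hornerE/=; ring.
  rewrite -pE; have -> : k1 + 2 * t * k2 + 3 * t ^+ 2 * k3 = p^`().[t].
    by rewrite !poly.derivE !hornerE/=; ring.
  exact: is_derive_poly.
have cD i : is_derive t 1 (fun s => c s 0 i : R) (hfield v (c t) 0 i).
  rewrite hE; under eq_fun do rewrite cE.
  case: i => -[|[|[|[|//]]]] hi.
  - rewrite (_ : Ordinal hi = 0); last exact: val_inj.
    rewrite row4E; under eq_fun do rewrite row4E.
    have := cP (x 0 0) (v 0 0) 0 0.
    rewrite !mulr0 !addr0. by under eq_fun do rewrite !mulr0 !addr0.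
  - rewrite (_ : Ordinal hi = 1); last exact: val_inj.
    rewrite row4E; under eq_fun do rewrite row4E.
    have := cP (x 0 1) (v 0 1) 0 0.
    rewrite !mulr0 !addr0. by under eq_fun do rewrite !mulr0 !addr0.
  - rewrite (_ : Ordinal hi = 2); last exact: val_inj.
    rewrite row4E; under eq_fun do rewrite row4E.
    have := cP (x 0 2) (x 0 0 * v 0 1) (v 0 0 * v 0 1 / 2) 0.
    rewrite !mulr0 !addr0. by under eq_fun do rewrite !mulr0 !addr0.
  - rewrite (_ : Ordinal hi = 3); last exact: val_inj.
    by rewrite row4E; under eq_fun do rewrite row4E; exact: cP.
have dM : derivable (c : R -> 'rV[R]_4) t 1.
  by apply/derivable_mxP => i j; rewrite ord1; case: (cD j).
apply: DeriveDef => //.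
rewrite derive_mx//; apply/rowP => j; rewrite mxE.
by case: (cD j).
Qed.

Section curves.
Context {R : realType}.
Implicit Types (al be : R) (g : R -> engel R) (u : R -> hlayer R).

(* A curve on [al, be] is a function on R of which only the restriction to
   `[al, be] is used. *)

Definition abs_cont al be g : Prop :=
  forall e : R, 0 < e -> exists2 d : R, 0 < d &
    forall (n : nat) (s t : 'I_n -> R),
      (forall i, al <= s i /\ s i <= t i /\ t i <= be) ->
      (forall i j, i != j -> t i <= s j \/ t j <= s i) ->
      \sum_(i < n) (t i - s i) < d ->
      \sum_(i < n) `|(g (t i) : 'rV[R]_4) - g (s i)| < e.

Definition horizontal al be g u : Prop :=
  [/\ abs_cont al be g,
      forall i : 'I_2, lebesgue_measure.-integrable `[al, be]
                         (fun t => (u t 0 i)%:E) &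
      {ae lebesgue_measure, forall t : R, `[al, be]%classic t ->
         is_derive t 1 (g : R -> 'rV[R]_4) (hfield (u t) (g t))}].

Definition hlength al be u : \bar R :=
  (\int[lebesgue_measure]_(t in `[al, be]) (hnorm (u t))%:E)%E.

Definition cc_dist (x y : engel R) : \bar R :=
  ereal_inf [set l | exists al be g u,
    [/\ al < be, horizontal al be g u, g al = x, g be = y &
        l = hlength al be u]].

(* The derivative along [al, be], one-sided at the end points. *)
Definition diff_quot g (t : R) : R -> 'rV[R]_4 :=
  fun s => (s - t)^-1 *: (g s - g t).

Definition derivable_on al be g (t : R) : Prop :=
  cvg (diff_quot g t @ within `[al, be] t^').

Definition derive_on al be g (t : R) : 'rV[R]_4 :=
  lim (diff_quot g t @ within `[al, be] t^').

Definition C1 al be g : Prop :=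
  (forall t, `[al, be]%classic t -> derivable_on al be g t) /\
  {within `[al, be], continuous (derive_on al be g)}.

Definition C1H al be : set (R -> engel R) :=
  [set g | C1 al be g /\ exists u, horizontal al be g u].

(* The vector g'(t) = u_1(t) X_1 + u_2(t) X_2 of V_1: its coordinates are the
   first two coordinates of the derivative of g, see hpart_hfield. *)
Definition hpart (x : 'rV[R]_4) : hlayer R := row2 (x 0 0) (x 0 1).

Lemma hpart_hfield (v : hlayer R) (x : engel R) : hpart (hfield v x) = v.
Proof.
apply/rowP => -[[|[|//]] hi]; rewrite !mxE /= ?(mulr0, mulr1, addr0, add0r).
- by congr (v 0 _); exact: val_inj.
- by congr (v 0 _); exact: val_inj.
Qed.

Definition hderive al be g (t : R) : hlayer R := hpart (derive_on al be g t).

Definition C1H_dist al be g1 g2 : \bar R :=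
  maxe (ereal_sup [set cc_dist (g1 t) (g2 t) | t in `[al, be]])
       (ereal_sup [set (hnorm (hderive al be g2 t - hderive al be g1 t))%:E
                  | t in `[al, be]]).

Definition C1H_nbhs al be g (V : set (R -> engel R)) : Prop :=
  V `<=` C1H al be /\
  exists2 e : R, 0 < e &
    [set s | C1H al be s /\ (C1H_dist al be g s < e%:E)%E] `<=` V.

Definition pliable al be g : Prop :=
  C1H al be g /\
  forall V : set (R -> engel R), C1H_nbhs al be g V ->
    nbhs ((g be, hderive al be g be) : 'rV[R]_4 * 'rV[R]_2)
      [set (s be, hderive al be s be)
      | s in [set s | V s /\
                      (s al, hderive al be s al) = (g al, hderive al be g al)]].

Definition pliable_vector (v : hlayer R) : Prop :=
  pliable 0 1 (fun t => engel_exp (t *: hlayer_incl v)).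

End curves.

(* Main.v *)
Require Import Defs.
From mathcomp Require Import all_boot all_order all_algebra.
From mathcomp Require Import all_classical all_reals all_analysis.
From mathcomp Require Import measurable_realfun.
From mathcomp Require Import ring lra.

Set Implicit Arguments.
Unset Strict Implicit.
Unset Printing Implicit Defensive.

Import Order.TTheory GRing.Theory Num.Theory.
Import numFieldNormedType.Exports.

Local Open Scope classical_set_scope.
Local Open Scope ring_scope.

(** Every curve built here is polynomial.  A polynomial [x] with [x.[0] = 0]
    and a polynomial [v] determine the horizontal curve [pcurve x v] issued
    from the origin, with controls [u_1 = x'] and [u_2 = v]; its end point is
    [(x(1), int v, int x v, int x^2 v / 2)].  Once [x] is chosen, the
    conditions on the end point and on [v(0)], [v(1)] are linear in [v], so
    that no implicit function theorem is needed: reaching all points and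
    directions near those of a reference curve comes down to a linear system
    that is invertible at the reference and stays so nearby.

    The reference has [x = s * phi] and [v] constant equal to [b].  Let
    [theta_0, ..., theta_3] vanish at 0 and be dual to the four functionals
    [f |-> int f, int phi f, int phi^2 f, f(1)].  Perturb [x] by
    [c_1 t^2 + c_2 t^3], which adjusts [x(1)] and [x'(1)], and [v] by a
    combination of the [theta_j].  The coefficients of [theta_0] and [theta_3]
    are then given outright by the target, and the other two solve a 2 x 2
    system close to the identity ([endpoint_cover]).  For [a <> 0] take
    [phi = t] and [s = a]: the reference is the curve [exp(tV)] itself.  For
    [a = b = 0] the reference cannot be the constant curve, whose end point
    map is degenerate; take instead [phi = t^3 (1-t)^2], for which
    [v = 0] gives a back-and-forth motion returning to the origin at rest,
    with [s] small enough to stay near the constant curve.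

    The topology of [C1H] also involves the Carnot-Caratheodory distance.
    The case [a = b = 0] provides short horizontal curves from the origin to
    all points of a neighbourhood, hence, by left translation, an upper bound
    of [cc_dist y (y * z)] that is uniform in [y] ([cc_dist_small]).  The
    element [z(t) = exp(tV)^-1 * sigma(t)] solves a triangular differential
    equation, so it is small as soon as the controls of [sigma] are close to
    [(a, b)] ([exp_pcurve_close]).  Together these give
    [pliable_controllable].

    Conversely let [a = 0] and [b <> 0].  Along a horizontal curve
    [x_4' = x_1^2 / 2 * x_2'], and for a curve close to [exp(tV)] the
    derivative [x_2'] keeps the sign of [b]; so [b * x_4] is nondecreasing
    and no point with [b * x_4 < 0] is reached, although such points
    accumulate at [exp V] ([contact_monotone], [not_pliable_vertical]). *)

(** * Derivatives on the unit interval *)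

Section derivative_on_unit_interval.
Context {R : realType}.
Implicit Types (g : R -> engel R) (t : R).

Lemma dnbhs_shift t (P : R -> Prop) :
  (\forall s \near t^', P s) = (\forall h \near 0^', P (h + t)).
Proof.
transitivity (\forall s \near t, s != t -> P s); first by [].
transitivity (\forall h \near 0, h != 0 -> P (h + t)); last by [].
rewrite (near_shift 0); congr (nbhs _ _); apply/funext => h /=.
by rewrite subr0 -[in LHS]subr_eq0 addrK.
Qed.

(** The two difference quotients differ by the translation [s = t + h]. *)
Lemma diff_quotP g t (l : 'rV[R]_4) :
  diff_quot g t @ t^' --> l <-> is_derive t 1 (g : R -> 'rV[R]_4) l.
Proof.
have E : (diff_quot g t @ t^' --> l) <->
  (h^-1 *: (((g : R -> 'rV[R]_4) \o shift t) (h *: 1) - g t) @[h --> 0^'] --> l).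
  have := @cvgrPdist_le R 'rV[R]_4 R^o t^' _ (diff_quot g t) l.
  have := @cvgrPdist_le R 'rV[R]_4 R^o 0^' _
    (fun h => h^-1 *: (((g : R -> 'rV[R]_4) \o shift t) (h *: 1) - g t)) l.
  move=> -> ->; split=> gl e e0; have := gl e e0.
    rewrite (dnbhs_shift t); apply: filterS => h.
    by rewrite /diff_quot /= addrK scaler1.
  rewrite (dnbhs_shift t); apply: filterS => h.
  by rewrite /diff_quot /= addrK scaler1.
rewrite E. split=> [gl|[gd <-]]; last exact: gd.
apply: DeriveDef; last exact/cvg_lim.
by apply/cvg_ex; exists l.
Qed.

(** Uniqueness of one-sided limits: every point of [0, 1], the end points
    included, is an accumulation point of [0, 1]. *)
Lemma within01_dnbhs_proper t : `[0, 1]%classic t ->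
  ProperFilter (within `[0, 1]%classic t^').
Proof.
rewrite /= in_itv /= => /andP[t0 t1]; split; last exact: within_filter.
rewrite /within /dnbhs /within /= => /nbhs_ballP[e /= e0].
have [t2|t2] := leP t 2^-1.
- pose d := Num.min (e / 2) 2^-1.
  have d0 : 0 < d by rewrite lt_min divr_gt0 //= invr_gt0.
  have dt : d <= 2^-1 by rewrite ge_min lexx orbT.
  have de : d < e by rewrite gt_min; apply/orP; left; lra.
  move=> /(_ (t + d)); apply.
  + by rewrite /ball /= opprD addrA subrr sub0r normrN gtr0_norm.
  + by rewrite -subr_eq0 addrC addKr gt_eqF.
  + by rewrite in_itv /=; apply/andP; split; lra.
- pose d := Num.min (e / 2) 2^-1.
  have d0 : 0 < d by rewrite lt_min divr_gt0 //= invr_gt0.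
  have dt : d <= 2^-1 by rewrite ge_min lexx orbT.
  have de : d < e by rewrite gt_min; apply/orP; left; lra.
  move=> /(_ (t - d)); apply.
  + by rewrite /ball /= opprB addrC subrK gtr0_norm.
  + by rewrite -subr_eq0 addrC addKr oppr_eq0 gt_eqF.
  + by rewrite in_itv /=; apply/andP; split; lra.
Qed.

Lemma derive_on_is_derive g t (l : 'rV[R]_4) : `[0, 1]%classic t ->
  is_derive t 1 (g : R -> 'rV[R]_4) l ->
  derivable_on 0 1 g t /\ derive_on 0 1 g t = l.
Proof.
move=> t01 /diff_quotP gl.
have gl' : diff_quot g t @ within `[0, 1]%classic t^' --> l.
  by apply: cvg_trans gl; apply: cvg_app; exact: cvg_within.
have ? := within01_dnbhs_proper t01.
split; last exact/cvg_lim.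
by apply/cvg_ex; exists l.
Qed.

Lemma is_derive_derive_on g t : `]0, 1[%classic t -> derivable_on 0 1 g t ->
  is_derive t 1 (g : R -> 'rV[R]_4) (derive_on 0 1 g t).
Proof.
move=> t01 gt; apply/diff_quotP.
apply: cvg_trans gt; apply: cvg_app => P; rewrite /within /dnbhs /within /=.
rewrite !nbhs_simpl /= => tP.
have I : nbhs t `]0, 1[%classic.
  by apply: open_nbhs_nbhs; split => //; exact: interval_open.
apply: filterS2 I tP => s s01 sP st.
by apply: sP => //; exact: subset_itv_oo_cc.
Qed.

End derivative_on_unit_interval.

(** * Polynomials on the unit interval *)

Section polynomials_on_unit_interval.
Context {R : realType}.
Implicit Types (p q v x : {poly R}) (t : R).

(** This norm bounds [|p|] on the unit interval. *)
Definition coef_norm p : R := \sum_(i < size p) `|p`_i|.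

Lemma coef_norm_ge0 p : 0 <= coef_norm p.
Proof. exact: sumr_ge0. Qed.

Lemma horner_le_coef_norm p t : 0 <= t <= 1 -> `|p.[t]| <= coef_norm p.
Proof.
move=> /andP[t0 t1]; rewrite horner_coef (le_trans (ler_norm_sum _ _ _))//.
apply: ler_sum => i _; rewrite normrM normrX (ger0_norm t0).
by rewrite ler_piMr// exprn_ile1.
Qed.

Lemma horner_lipschitz p (M s t : R) :
  (forall r, 0 <= r <= 1 -> `|p^`().[r]| <= M) ->
  0 <= s -> s <= t -> t <= 1 -> `|p.[t] - p.[s]| <= M * (t - s).
Proof.
move=> pM s0 st t1.
have pd (r : R) : r \in `]s, t[ -> is_derive r 1 (horner p) p^`().[r].
  by move=> _; exact: is_derive_poly.
have [|c] := MVT_segment st pd.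
  by apply: continuous_subspaceT; exact: continuous_horner.
rewrite in_itv /= => /andP[sc ct] ->.
rewrite normrM [`|t - s|]ger0_norm ?subr_ge0// ler_wpM2r ?subr_ge0//.
by apply: pM; rewrite (le_trans s0 sc) (le_trans ct t1).
Qed.

Lemma horner_le_deriv p (M t : R) : p.[0] = 0 ->
  (forall r, 0 <= r <= 1 -> `|p^`().[r]| <= M) ->
  0 <= t <= 1 -> `|p.[t]| <= M.
Proof.
move=> p0 pM /andP[t0 t1].
have := horner_lipschitz pM (lexx 0) t0 t1; rewrite p0 !subr0 => /le_trans -> //.
rewrite ler_piMr//; apply: le_trans (pM 0 _); first exact: normr_ge0.
by rewrite lexx ler01.
Qed.

(** The antiderivative vanishing at 0.  The coefficient of index 0 is right
    because [x / 0 = 0]. *)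
Definition prim p : {poly R} := \poly_(i < (size p).+1) (p`_i.-1 / i%:R).

Lemma coef_prim p i : (prim p)`_i = p`_i.-1 / i%:R.
Proof.
rewrite coef_poly ltnS; case: leqP => // ip.
case: i ip => [//|i] ip; by rewrite nth_default// mul0r.
Qed.

Lemma deriv_prim p : (prim p)^`() = p.
Proof.
apply/polyP => i; rewrite coef_deriv coef_prim /= -[LHS]mulr_natr.
by rewrite divfK ?pnatr_eq0.
Qed.

Lemma prim0 p : (prim p).[0] = 0.
Proof. by rewrite horner_coef0 coef_prim invr0 mulr0. Qed.

Lemma primD p q : prim (p + q) = prim p + prim q.
Proof. by apply/polyP => i; rewrite coefD !coef_prim coefD mulrDl. Qed.

Lemma primZ (k : R) p : prim (k *: p) = k *: prim p.
Proof. by apply/polyP => i; rewrite coefZ !coef_prim coefZ mulrA. Qed.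

Lemma primXn n : prim 'X^n = n.+1%:R^-1 *: 'X^(n.+1).
Proof.
apply/polyP => -[|i]; rewrite coefZ coef_prim !coefXn /=.
  by rewrite invr0 !mulr0.
rewrite eqSS; case: eqP => [->|_]; by rewrite ?mul0r ?mulr0// mul1r mulr1.
Qed.

(** The integral of [p] over the unit interval. *)
Definition pint p : R := (prim p).[1].

Lemma pintD p q : pint (p + q) = pint p + pint q.
Proof. by rewrite /pint primD hornerD. Qed.

Lemma pintZ (k : R) p : pint (k *: p) = k * pint p.
Proof. by rewrite /pint primZ hornerZ. Qed.

Lemma pintXn n : pint 'X^n = n.+1%:R^-1.
Proof. by rewrite /pint primXn hornerZ hornerXn expr1n mulr1. Qed.

End polynomials_on_unit_interval.

(** * Polynomial horizontal curves *)

Section polynomial_curves.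
Context {R : realType}.
Implicit Types (p q r s v x : {poly R}) (t : R).

Definition polycurve p q r s : R -> engel R :=
  fun t => row4 p.[t] q.[t] r.[t] s.[t].

(** The equations [x_3' = x_1 x_2'] and [x_4' = x_1^2 / 2 x_2'], which say
    that the velocity is a combination of [X_1] and [X_2]. *)
Definition horizontal_poly p q r s : Prop :=
  r^`() = p * q^`() /\ s^`() = 2^-1 *: (p ^+ 2 * q^`()).

Lemma ord4_ind (P : 'I_4 -> Prop) : P 0 -> P 1 -> P 2 -> P 3 -> forall i, P i.
Proof.
move=> h0 h1 h2 h3 [[|[|[|[|//]]]] hi].
- by rewrite (_ : Ordinal hi = 0) //; exact: val_inj.
- by rewrite (_ : Ordinal hi = 1) //; exact: val_inj.
- by rewrite (_ : Ordinal hi = 2) //; exact: val_inj.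
- by rewrite (_ : Ordinal hi = 3) //; exact: val_inj.
Qed.

Lemma row4_norm_le (y : 'rV[R]_4) (M : R) :
  (forall i, `|y 0 i| <= M) -> `|y| <= M.
Proof.
move=> yM; rewrite /Num.Def.normr /= mx_normrE bigmax_le//.
  exact: le_trans (yM 0).
by move=> [i j] _ /=; rewrite ord1.
Qed.

Lemma is_derive_polycurve p q r s t :
  is_derive t 1 (polycurve p q r s : R -> 'rV[R]_4)
    (polycurve p^`() q^`() r^`() s^`() t).
Proof.
have cD i : is_derive t 1 (fun u => polycurve p q r s u 0 i : R)
    (polycurve p^`() q^`() r^`() s^`() t 0 i).
  by elim/ord4_ind: i; rewrite /polycurve row4E; under eq_fun do rewrite row4E;
    exact: is_derive_poly.
have dM : derivable (polycurve p q r s : R -> 'rV[R]_4) t 1.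
  by apply/derivable_mxP => i j; rewrite ord1; case: (cD j).
apply: DeriveDef => //; rewrite derive_mx//; apply/rowP => j; rewrite mxE.
by case: (cD j).
Qed.

Lemma derive_on_polycurve p q r s t : `[0, 1]%classic t ->
  derivable_on 0 1 (polycurve p q r s) t /\
  derive_on 0 1 (polycurve p q r s) t = polycurve p^`() q^`() r^`() s^`() t.
Proof.
by move=> t01; apply: derive_on_is_derive => //; exact: is_derive_polycurve.
Qed.

Lemma hderive_polycurve p q r s t : `[0, 1]%classic t ->
  hderive 0 1 (polycurve p q r s) t = row2 p^`().[t] q^`().[t].
Proof.
move=> t01; rewrite /hderive (derive_on_polycurve _ _ _ _ t01).2.
by rewrite /hpart !row4E.
Qed.

Lemma continuous_polycurve p q r s :
  continuous (polycurve p q r s : R -> 'rV[R]_4).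
Proof.
move=> t; apply: differentiable_continuous; apply/derivable1_diffP.
exact: (@ex_derive _ _ _ _ _ _ _ (is_derive_polycurve p q r s t)).
Qed.

Lemma C1_polycurve p q r s : C1 0 1 (polycurve p q r s).
Proof.
split=> [t t01|]; first exact: (derive_on_polycurve _ _ _ _ t01).1.
apply: (@subspace_eq_continuous R `[0, 1]%classic 'rV[R]_4
  (polycurve p^`() q^`() r^`() s^`())).
  move=> t; rewrite inE => t01.
  exact: esym (derive_on_polycurve p q r s t01).2.
by apply: continuous_subspaceT; exact: continuous_polycurve.
Qed.

(** Polynomial curves are Lipschitz on the unit interval. *)
Lemma abs_cont_polycurve p q r s : abs_cont 0 1 (polycurve p q r s).
Proof.
move=> e e0.
pose L := 1 + (coef_norm p^`() + coef_norm q^`() + coef_norm r^`() +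
               coef_norm s^`()).
have H := @coef_norm_ge0 R.
have L0 : 0 < L by rewrite ltr_pwDl// !addr_ge0.
exists (e / L); first exact: divr_gt0.
move=> n a b ab _; rewrite ltr_pdivlMr// => abe.
apply: le_lt_trans abe; rewrite mulr_suml; apply: ler_sum => i _.
have [a0 [abi b1]] := ab i.
apply: row4_norm_le => j; rewrite !mxE.
have lip u : coef_norm u^`() <= L ->
    `|u.[b i] - u.[a i]| <= (b i - a i) * L.
  move=> uL; rewrite mulrC; apply: horner_lipschitz => // t t01.
  exact: le_trans (horner_le_coef_norm _ t01) uL.
have := H p^`(); have := H q^`(); have := H r^`(); have := H s^`().
by elim/ord4_ind: j => /= ? ? ? ?; apply: lip; rewrite /L; lra.
Qed.

Lemma horizontal_polycurve p q r s : horizontal_poly p q r s ->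
  horizontal 0 1 (polycurve p q r s) (fun t => row2 p^`().[t] q^`().[t]).
Proof.
move=> [rE sE]; split; first exact: abs_cont_polycurve.
- move=> i.
  have intp u : lebesgue_measure.-integrable `[0, 1] (fun t : R => (u.[t])%:E).
    apply: continuous_compact_integrable; first exact: segment_compact.
    by apply: continuous_subspaceT; exact: continuous_horner.
  case: i => -[|[|//]] hi;
    by [apply: eq_integrable (intp p^`()) => // t _; rewrite mxE
       |apply: eq_integrable (intp q^`()) => // t _; rewrite mxE].
- apply: aeW => t _; have := is_derive_polycurve p q r s t.
  congr (is_derive _ _ _ _); rewrite /polycurve /hfield !mxE /=.
  by rewrite rE sE !hornerE; apply: row4P; rewrite !mxE /=; field.
Qed.

Lemma C1H_polycurve p q r s : horizontal_poly p q r s ->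
  C1H 0 1 (polycurve p q r s).
Proof.
move=> h; split; first exact: C1_polycurve.
by eexists; exact: horizontal_polycurve h.
Qed.

Lemma hnorm_le (a b e : R) : `|a| <= e -> `|b| <= e -> hnorm (row2 a b) <= 2 * e.
Proof.
move=> ae be; have e0 : 0 <= e by exact: le_trans ae.
rewrite /hnorm !mxE /= -[leRHS]ger0_norm ?mulr_ge0// -sqrtr_sqr ler_sqrt ?sqr_ge0//.
have : a ^+ 2 <= e ^+ 2 by rewrite -real_normK ?num_real// lerXn2r ?nnegrE.
have : b ^+ 2 <= e ^+ 2 by rewrite -real_normK ?num_real// lerXn2r ?nnegrE.
have := sqr_ge0 e; rewrite exprMn; lra.
Qed.

(** The length of a curve on the unit interval is at most the supremum of
    its speed. *)
Lemma cc_dist_polycurve p q r s (e : R) : horizontal_poly p q r s ->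
  (forall t, 0 <= t <= 1 -> `|p^`().[t]| <= e /\ `|q^`().[t]| <= e) ->
  (cc_dist (polycurve p q r s 0) (polycurve p q r s 1) <= (2 * e)%:E)%E.
Proof.
move=> h pqe; pose u t := row2 p^`().[t] q^`().[t].
apply: (@le_trans _ _ (hlength 0 1 u)).
  apply: ereal_inf_lbound; exists 0, 1, (polycurve p q r s), u; split => //.
  exact: horizontal_polycurve.
rewrite /hlength; apply: (@le_trans _ _
    (\int[lebesgue_measure]_(t in `[0%R, 1%R]) (2 * e)%:E)%E).
  apply: ge0_le_integral => //=.
  - by move=> t _; rewrite lee_fin sqrtr_ge0.
  - apply/measurable_EFinP; rewrite /hnorm.
    have -> : (fun t => Num.sqrt (u t 0 0 ^+ 2 + u t 0 1 ^+ 2)) =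
      Num.sqrt \o (horner (p^`() ^+ 2 + q^`() ^+ 2)).
      by apply/funext => t /=; rewrite !mxE /= !hornerE.
    apply: measurable_funTS; apply: continuous_measurable_fun => x.
    by apply: continuous_comp; [exact: continuous_horner|exact: sqrt_continuous].
  - move=> t; rewrite in_itv /= => /pqe[pe qe].
    by rewrite lee_fin; exact: hnorm_le.
rewrite integral_cst//= lebesgue_measure_itv /= lte_fin ltr01 oppr0 adde0.
by rewrite mule1.
Qed.

End polynomial_curves.

(** * The end point map near a polynomial curve *)

Section endpoint_map.
Context {R : realType}.
Implicit Types (phi v x : {poly R}) (t : R).

(** The horizontal curve with controls [u_1 = x'] and [u_2 = v]; it starts
    at the origin when [x.[0] = 0]. *)
Definition pcurve x v : R -> engel R :=
  polycurve x (prim v) (prim (x * v)) (prim (2^-1 *: (x ^+ 2 * v))).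

Lemma horizontal_pcurve x v :
  horizontal_poly x (prim v) (prim (x * v)) (prim (2^-1 *: (x ^+ 2 * v))).
Proof. by split; rewrite !deriv_prim. Qed.

Lemma pcurve0 x v : x.[0] = 0 -> pcurve x v 0 = 0.
Proof.
move=> x0; rewrite /pcurve /polycurve x0 !prim0.
by apply: row4P; rewrite !mxE.
Qed.

(** At [t = 0] the perturbations must vanish since the initial direction is
    prescribed; the four other conditions make [th] the dual basis of the
    functionals that compute the last three coordinates of the end point (for
    [x_1] proportional to [phi]) and the final value of [u_2]. *)
Definition dual_system phi (th : 'I_4 -> {poly R}) : Prop := forall i,
  [/\ (th i).[0] = 0, pint (th i) = (i == 0)%:R,
      pint (phi * th i) = (i == 1)%:R, pint (phi ^+ 2 * th i) = (i == 2)%:R &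
      (th i).[1] = (i == 3)%:R].

Section null_functions.
Context {T : topologicalType} (z0 : T).
Implicit Types f g : T -> R.

(** Only sums and products of functions tending to 0 are needed: the
    coefficients of the perturbation are polynomials without constant term in
    the deviation of the target, up to one denominator tending to 1. *)
Definition null f := f z @[z --> z0] --> (0 : R).

Lemma nullD f g : null f -> null g -> null (fun z => f z + g z).
Proof. by move=> f0 g0; have := cvgD f0 g0; rewrite addr0; exact. Qed.

Lemma nullM f g : null f -> null g -> null (fun z => f z * g z).
Proof. by move=> f0 g0; have := cvgM f0 g0; rewrite mulr0; exact. Qed.

Lemma nullZ (k : R) f : null f -> null (fun z => k * f z).
Proof. by move=> f0; have := cvgM (cvg_cst k) f0; rewrite mulr0; exact. Qed.

Lemma nullB f g : null f -> null g -> null (fun z => f z - g z).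
Proof. by move=> f0 g0; have := cvgB f0 g0; rewrite subr0; exact. Qed.

Lemma null_near f (e : R) : null f -> 0 < e -> \forall z \near z0, `|f z| <= e.
Proof.
move=> /cvgrPdist_le f0 /f0; apply: filterS => z.
by rewrite sub0r normrN.
Qed.

Lemma null_sub f : {for z0, continuous f} -> null (fun z => f z - f z0).
Proof. by move=> fc; have := cvgB fc (cvg_cst (f z0)); rewrite subrr; exact. Qed.

End null_functions.

Section perturbed_controls.
Context (phi : {poly R}) (th : 'I_4 -> {poly R}) (s b c1 c2 d0 d1 d2 d3 : R).
Context (dual : dual_system phi th) (s0 : s != 0).

(** The terms in [t^2] and [t^3] leave [x(0)] and [x'(0)] unchanged while
    prescribing [x(1)] and [x'(1)]. *)
Definition pert_x := s *: phi + (c1 *: 'X^2 + c2 *: 'X^3).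

(** The elements 1 and 2 of the dual system, rescaled so that they are dual
    to [f |-> int x f] and [f |-> int x^2 f / 2] for [x = s * phi]. *)
Definition dual1 := s^-1 *: th 1.
Definition dual2 := (2 * s^-1 ^+ 2) *: th 2.

Definition pert_v := b%:P + (d0 *: th 0 + d1 *: dual1 + d2 *: dual2 + d3 *: th 3).

(** The changes of [int x f] and [int x^2 f / 2] caused by the perturbation
    of [x]; they are the entries of the difference between the linear system
    and the identity. *)
Definition defect1 (f : {poly R}) : R :=
  pint ('X^2 * f) * c1 + pint ('X^3 * f) * c2.

Definition defect2 (f : {poly R}) : R :=
  s * pint (phi * 'X^2 * f) * c1 + s * pint (phi * 'X^3 * f) * c2
  + 2^-1 * pint ('X^4 * f) * (c1 * c1) + pint ('X^5 * f) * (c1 * c2)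
  + 2^-1 * pint ('X^6 * f) * (c2 * c2).

Lemma deriv_pert_x :
  pert_x^`() = s *: phi^`() + ((2 * c1) *: 'X + (3 * c2) *: 'X^2).
Proof. rewrite /pert_x !poly.derivE/= -!mul_polyC; ring. Qed.

Lemma pint_mul_pert_x f : pint (pert_x * f) = s * pint (phi * f) + defect1 f.
Proof.
rewrite /pert_x /defect1 !mulrDl -!scalerAl !(pintD, pintZ).
by rewrite [c1 * _]mulrC [c2 * _]mulrC.
Qed.

(** [defect2] is the expansion of
    [((s phi + c_1 t^2 + c_2 t^3)^2 - (s phi)^2) / 2]. *)
Lemma pint_mul_sqr_pert_x f : pint (2^-1 *: (pert_x ^+ 2 * f)) =
  s ^+ 2 / 2 * pint (phi ^+ 2 * f) + defect2 f.
Proof.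
have -> : pert_x ^+ 2 * f = (s ^+ 2) *: (phi ^+ 2 * f)
    + (2 * s * c1) *: (phi * 'X^2 * f) + (2 * s * c2) *: (phi * 'X^3 * f)
    + (c1 ^+ 2) *: ('X^4 * f) + (2 * c1 * c2) *: ('X^5 * f)
    + (c2 ^+ 2) *: ('X^6 * f).
  rewrite /pert_x -!mul_polyC; ring.
by rewrite /defect2 !(pintD, pintZ); field.
Qed.

Lemma pint_mul_pert_v f : pint (f * pert_v) =
  b * pint (f * 1) + (d0 * pint (f * th 0) + d1 * pint (f * dual1)
                + d2 * pint (f * dual2) + d3 * pint (f * th 3)).
Proof.
rewrite /pert_v !mulrDr -!scalerAr !(pintD, pintZ); congr (_ + _).
by rewrite -alg_polyC -scalerAr pintZ.
Qed.

Lemma pert_v0 : pert_v.[0] = b.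
Proof.
rewrite /pert_v /dual1 /dual2 !(hornerD, hornerZ, hornerC).
have [-> _ _ _ _] := dual 0; have [-> _ _ _ _] := dual 1.
have [-> _ _ _ _] := dual 2; have [-> _ _ _ _] := dual 3.
by ring.
Qed.

Lemma pert_v1 : pert_v.[1] = b + d3.
Proof.
rewrite /pert_v /dual1 /dual2 !(hornerD, hornerZ, hornerC).
have [_ _ _ _ ->] := dual 0; have [_ _ _ _ ->] := dual 1.
have [_ _ _ _ ->] := dual 2; have [_ _ _ _ ->] := dual 3.
by rewrite /=; ring.
Qed.

Lemma pint_one : pint (1 : {poly R}) = 1.
Proof. by rewrite -(expr0 'X) pintXn invr1. Qed.

Lemma pint_pert_v : pint pert_v = b + d0.
Proof.
rewrite -[X in pint X]mul1r pint_mul_pert_v !mul1r /dual1 /dual2 !pintZ pint_one.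
have [_ -> _ _ _] := dual 0; have [_ -> _ _ _] := dual 1.
have [_ -> _ _ _] := dual 2; have [_ -> _ _ _] := dual 3.
by rewrite /=; ring.
Qed.

Lemma pint_mul_dual1 f : pint (f * dual1) = s^-1 * pint (f * th 1).
Proof. by rewrite /dual1 -scalerAr pintZ. Qed.

Lemma pint_mul_dual2 f : pint (f * dual2) = 2 * s^-1 ^+ 2 * pint (f * th 2).
Proof. by rewrite /dual2 -scalerAr pintZ. Qed.

Lemma pint_pert_xv : pint (pert_x * pert_v) =
  b * (s * pint phi + defect1 1)
  + (d0 * defect1 (th 0) + d1 * (1 + defect1 dual1) + d2 * defect1 dual2
     + d3 * defect1 (th 3)).
Proof.
rewrite pint_mul_pert_v !pint_mul_pert_x mulr1 pint_mul_dual1 pint_mul_dual2.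
have [_ _ -> _ _] := dual 0; have [_ _ -> _ _] := dual 1.
have [_ _ -> _ _] := dual 2; have [_ _ -> _ _] := dual 3.
by rewrite /=; field.
Qed.

Lemma pint_pert_xxv : pint (2^-1 *: (pert_x ^+ 2 * pert_v)) =
  b * (s ^+ 2 / 2 * pint (phi ^+ 2) + defect2 1)
  + (d0 * defect2 (th 0) + d1 * defect2 dual1 + d2 * (1 + defect2 dual2)
     + d3 * defect2 (th 3)).
Proof.
have E f : pint (pert_x ^+ 2 * f) =
    2 * (s ^+ 2 / 2 * pint (phi ^+ 2 * f) + defect2 f).
  by rewrite -pint_mul_sqr_pert_x pintZ; field.
rewrite pintZ pint_mul_pert_v !E mulr1 pint_mul_dual1 pint_mul_dual2.
have [_ _ _ -> _] := dual 0; have [_ _ _ -> _] := dual 1.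
have [_ _ _ -> _] := dual 2; have [_ _ _ -> _] := dual 3.
move: (defect2 _) (defect2 _) (defect2 _) (defect2 _) (defect2 _) (pint _).
by move=> *; rewrite /=; field.
Qed.

Lemma deriv_pert_x_close (a eta t : R) : 0 < eta -> 0 <= t <= 1 ->
  `|s * phi^`().[t] - a| <= eta / 2 ->
  `|c1| <= eta / 10 -> `|c2| <= eta / 10 -> `|pert_x^`().[t] - a| <= eta.
Proof.
move=> eta0 /andP[t0 t1] phi'a c1e c2e.
rewrite deriv_pert_x !(hornerD, hornerZ, hornerX, hornerXn).
have tt : t ^+ 2 <= 1 by rewrite exprn_ile1.
have tc1 : `|c1 * t| <= eta / 10.
  by rewrite normrM (ger0_norm t0) (le_trans _ c1e)// ler_piMr.
have tc2 : `|c2 * t ^+ 2| <= eta / 10.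
  by rewrite normrM (ger0_norm (sqr_ge0 t)) (le_trans _ c2e)// ler_piMr.
by move: phi'a tc1 tc2; rewrite !ler_norml => /andP[? ?] /andP[? ?] /andP[? ?];
  apply/andP; split; lra.
Qed.

Lemma pert_v_close (k t : R) : 0 <= t <= 1 ->
  `|d0| <= k -> `|d1| <= k -> `|d2| <= k -> `|d3| <= k ->
  `|pert_v.[t] - b| <= k * (coef_norm (th 0) + coef_norm dual1 + coef_norm dual2
                            + coef_norm (th 3)).
Proof.
move=> t01 d0k d1k d2k d3k.
have H d f : `|d| <= k -> `|d * f.[t]| <= k * coef_norm f.
  by move=> dk; rewrite normrM ler_pM// horner_le_coef_norm.
rewrite /pert_v; move: dual1 dual2 => g1 g2.
rewrite hornerD hornerC addrC addKr !(hornerD _ _ t) !(hornerZ _ _ t) !mulrDr.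
do 3 (apply: le_trans (ler_normD _ _) _; apply: lerD; last exact: H).
exact: H.
Qed.

End perturbed_controls.

Lemma small_denominator (D : R) : `|D| <= 2^-1 ->
  1 + D != 0 /\ forall n k : R, `|n| <= k / 2 -> `|n / (1 + D)| <= k.
Proof.
rewrite ler_norml => /andP[D1 _]; have D0 : 0 < 1 + D by lra.
split=> [|n k nk]; first by rewrite gt_eqF.
rewrite normrM normfV (gtr0_norm D0) ler_pdivrMr// (le_trans nk)//.
rewrite ler_wpM2l//; last by lra.
by have := le_trans (normr_ge0 n) nk; rewrite pmulr_lge0 ?invr_gt0.
Qed.

(** Cramer's rule for a system written as a perturbation of the identity. *)
Lemma cramer2 (a11 a12 a21 a22 r1 r2 : R) :
  let D := a11 + a22 + (a11 * a22 - a12 * a21) in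
  let x1 := (r1 + (a22 * r1 - a12 * r2)) / (1 + D) in
  let x2 := (r2 + (a11 * r2 - a21 * r1)) / (1 + D) in
  1 + D != 0 ->
  x1 * (1 + a11) + x2 * a12 = r1 /\ x1 * a21 + x2 * (1 + a22) = r2.
Proof. by move=> D x1 x2 D0; split; rewrite /x1 /x2 /D; field. Qed.

Lemma row_solved (p b A l d0 u m1 m2 d3 w : R) :
  m1 + m2 = p - b * l - d0 * u - d3 * w ->
  b * A + p = b * (A + l) + (d0 * u + m1 + m2 + d3 * w).
Proof. by move=> h; rewrite -(addrA (d0 * u)) h; ring. Qed.

(** All targets near the final state of the reference curve [(s * phi, b)] are
    reached with controls as close to [(a, b)] as wished.  The controls of the
    reference may themselves be at distance [eta / 2] from [(a, b)], so that
    the constant curve can be handled through a reference that moves. *)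
Lemma endpoint_cover phi (th : 'I_4 -> {poly R}) (s a b eta : R) :
  dual_system phi th -> s != 0 -> 0 < eta -> phi.[0] = 0 ->
  s * phi^`().[0] = a ->
  (forall t, 0 <= t <= 1 -> `|s * phi^`().[t] - a| <= eta / 2) ->
  \forall z \near ((row4 (s * phi.[1]) b (b * (s * pint phi))
                        (b * (s ^+ 2 / 2 * pint (phi ^+ 2))),
                   row2 (s * phi^`().[1]) b) : 'rV[R]_4 * 'rV[R]_2),
  exists x v, [/\ x.[0] = 0, x^`().[0] = a, v.[0] = b,
    z = (pcurve x v 1, row2 x^`().[1] v.[1]) &
    forall t, 0 <= t <= 1 -> `|x^`().[t] - a| <= eta /\ `|v.[t] - b| <= eta].
Proof.
move=> dual s0 eta0 phi0 phi'0 phi'a.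
set z0 := (row4 _ _ _ _, row2 _ _).
(* Deviations of the target from the final state of the reference. *)
pose P i (z : 'rV[R]_4 * 'rV[R]_2) := z.1 0 i - z0.1 0 i.
pose W i (z : 'rV[R]_4 * 'rV[R]_2) := z.2 0 i - z0.2 0 i.
have nP i : null z0 (P i).
  apply: (null_sub (f := fun z : 'rV[R]_4 * 'rV[R]_2 => z.1 0 i)).
  apply: (@cvg_comp _ _ _ fst (fun m : 'rV[R]_4 => m 0 i)).
    exact: cvg_fst.
  exact: coord_continuous.
have nW i : null z0 (W i).
  apply: (null_sub (f := fun z : 'rV[R]_4 * 'rV[R]_2 => z.2 0 i)).
  apply: (@cvg_comp _ _ _ snd (fun m : 'rV[R]_2 => m 0 i)).
    exact: cvg_snd.
  exact: coord_continuous.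
(* The solution of [c1 + c2 = P 0 z] and [2 c1 + 3 c2 = W 0 z]. *)
pose c1 z := 3 * P 0 z - W 0 z.
pose c2 z := W 0 z - 2 * P 0 z.
have nc1 : null z0 c1 by apply: nullB => //; exact: nullZ.
have nc2 : null z0 c2 by apply: nullB => //; exact: nullZ.
pose l1 f z := defect1 (c1 z) (c2 z) f.
pose l2 f z := defect2 phi s (c1 z) (c2 z) f.
have nl1 f : null z0 (l1 f) by apply: nullD; exact: nullZ.
have nl2 f : null z0 (l2 f).
  apply: nullD; last by apply: nullZ; exact: nullM.
  apply: nullD; last by apply: nullZ; exact: nullM.
  apply: nullD; last by apply: nullZ; exact: nullM.
  by apply: nullD; exact: nullZ.
(* By duality [int v] and [v(1)] involve only [d0] and [d3], respectively. *)
pose d0 z := P 1 z.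
pose d3 z := W 1 z.
pose r1 z := P 2 z - b * l1 1 z - d0 z * l1 (th 0) z - d3 z * l1 (th 3) z.
pose r2 z := P 3 z - b * l2 1 z - d0 z * l2 (th 0) z - d3 z * l2 (th 3) z.
have nd0 : null z0 d0 by exact: nP.
have nd3 : null z0 d3 by exact: nW.
have nr1 : null z0 r1.
  apply: nullB; last exact: nullM.
  apply: nullB; last exact: nullM.
  by apply: nullB; [exact: nP|exact: nullZ].
have nr2 : null z0 r2.
  apply: nullB; last exact: nullM.
  apply: nullB; last exact: nullM.
  by apply: nullB; [exact: nP|exact: nullZ].
(* The determinant is [1 + D]; [n1] and [n2] are the Cramer numerators. *)
pose q1 := dual1 th s.
pose q2 := dual2 th s.
pose D z := l1 q1 z + l2 q2 z + (l1 q1 z * l2 q2 z - l1 q2 z * l2 q1 z).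
have nD : null z0 D.
  by apply: nullD; [exact: nullD|apply: nullB; exact: nullM].
pose n1 z := r1 z + (l2 q2 z * r1 z - l1 q2 z * r2 z).
pose n2 z := r2 z + (l1 q1 z * r2 z - l2 q1 z * r1 z).
have nn1 : null z0 n1 by apply: nullD => //; apply: nullB; exact: nullM.
have nn2 : null z0 n2 by apply: nullD => //; apply: nullB; exact: nullM.
pose N := 1 + (coef_norm (th 0) + coef_norm q1 + coef_norm q2 + coef_norm (th 3)).
have N0 : 0 < N by rewrite ltr_pwDl// !addr_ge0// coef_norm_ge0.
pose k := eta / N.
have k0 : 0 < k by exact: divr_gt0.
(* [2 / 10 + 3 / 10 = 1 / 2] bounds the derivative of [c1 t^2 + c2 t^3]. *)
have [eta10 k2 h2] : [/\ 0 < eta / 10, 0 < k / 2 & 0 < (2^-1 : R)].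
  by split; rewrite ?divr_gt0 ?invr_gt0.
near=> z.
have c1z : `|c1 z| <= eta / 10 by near: z; exact: null_near nc1 eta10.
have c2z : `|c2 z| <= eta / 10 by near: z; exact: null_near nc2 eta10.
have d0z : `|d0 z| <= k by near: z; exact: null_near nd0 k0.
have d3z : `|d3 z| <= k by near: z; exact: null_near nd3 k0.
have Dz : `|D z| <= 2^-1 by near: z; exact: null_near nD h2.
have n1z : `|n1 z| <= k / 2 by near: z; exact: null_near nn1 k2.
have n2z : `|n2 z| <= k / 2 by near: z; exact: null_near nn2 k2.
have [D0 div_small] := small_denominator Dz.
pose d1 := n1 z / (1 + D z).
pose d2 := n2 z / (1 + D z).
have [row1 row2] := cramer2 (r1 z) (r2 z) D0.
have d1z : `|d1| <= k by exact: div_small.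
have d2z : `|d2| <= k by exact: div_small.
exists (pert_x phi s (c1 z) (c2 z)), (pert_v th s b (d0 z) d1 d2 (d3 z)); split.
- by rewrite /pert_x !(hornerD, hornerZ, hornerXn) phi0 !expr0n /= !mulr0 !addr0.
- rewrite deriv_pert_x !(hornerD, hornerZ, hornerXn, hornerX) phi'0.
  by rewrite !expr0n /= !mulr0 !addr0.
- exact: pert_v0.
- have PE i : z.1 0 i = z0.1 0 i + P i z by rewrite /P addrC subrK.
  have WE i : z.2 0 i = z0.2 0 i + W i z by rewrite /W addrC subrK.
  rewrite [LHS]surjective_pairing; congr pair.
    apply: row4P; rewrite PE /pcurve /polycurve !row4E -?/(pint _).
    + rewrite /pert_x !(hornerD, hornerZ, hornerXn) !expr1n !mulr1 /c1 /c2.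
      by ring.
    + by rewrite (pint_pert_v _ _ _ _ _ _ dual).
    + rewrite (pint_pert_xv _ _ _ _ _ _ _ dual s0); exact: row_solved row1.
    + rewrite (pint_pert_xxv _ _ _ _ _ _ _ dual s0); exact: row_solved row2.
  apply/rowP => i; rewrite WE !mxE; case: i => -[|[|//]] hi /=.
  + rewrite deriv_pert_x !(hornerD, hornerZ, hornerX, hornerXn) expr1n /c1 /c2.
    rewrite (_ : Ordinal hi = 0); last exact: val_inj.
    by ring.
  + rewrite (pert_v1 _ _ _ _ _ _ dual) (_ : Ordinal hi = 1) //.
    exact: val_inj.
- move=> t t01; split; first exact: deriv_pert_x_close (phi'a _ t01) _ _.
  apply: le_trans (pert_v_close th s b t01 d0z d1z d2z d3z) _.
  rewrite /k mulrAC -mulrA ler_piMr ?(ltW eta0)// ler_pdivrMr// mul1r /N.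
  by rewrite lerDr.
Unshelve. all: by end_near.
Qed.
End endpoint_map.

(** * Two dual systems *)

Section dual_systems.
Context {R : realType}.

(** The common factor [k] keeps the remaining coefficients small integers. *)
Definition comb4 (k c1 c2 c3 c4 : R) (e1 e2 e3 e4 : nat) : {poly R} :=
  k *: (c1 *: 'X^e1 + c2 *: 'X^e2 + c3 *: 'X^e3 + c4 *: 'X^e4).

Lemma pint_Xn_comb4 (n : nat) (k c1 c2 c3 c4 : R) (e1 e2 e3 e4 : nat) :
  pint ('X^n * comb4 k c1 c2 c3 c4 e1 e2 e3 e4) =
  k * (c1 / (n + e1).+1%:R + c2 / (n + e2).+1%:R + c3 / (n + e3).+1%:R
       + c4 / (n + e4).+1%:R).
Proof.
rewrite /comb4 -scalerAr pintZ; congr (k * _).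
rewrite !mulrDr -!scalerAr -!exprD.
by rewrite !(pintD, pintZ, pintXn).
Qed.

Lemma pint_comb4 (k c1 c2 c3 c4 : R) (e1 e2 e3 e4 : nat) :
  pint (comb4 k c1 c2 c3 c4 e1 e2 e3 e4) =
  k * (c1 / e1.+1%:R + c2 / e2.+1%:R + c3 / e3.+1%:R + c4 / e4.+1%:R).
Proof. by rewrite -[X in pint X]mul1r -(expr0 'X) pint_Xn_comb4. Qed.

Lemma comb4_1 (k c1 c2 c3 c4 : R) (e1 e2 e3 e4 : nat) :
  (comb4 k c1 c2 c3 c4 e1 e2 e3 e4).[1] = k * (c1 + c2 + c3 + c4).
Proof. by rewrite /comb4 !(hornerD, hornerZ, hornerXn) !expr1n !mulr1. Qed.

Lemma comb4_0 (k c1 c2 c3 c4 : R) (e1 e2 e3 e4 : nat) :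
  (comb4 k c1 c2 c3 c4 e1.+1 e2.+1 e3.+1 e4.+1).[0] = 0.
Proof.
by rewrite /comb4 !(hornerD, hornerZ, hornerXn) !expr0n /= !mulr0 !addr0 mulr0.
Qed.

(** The columns of the inverse of the 4 x 4 matrix of the functionals
    [int f, int t f, int t^2 f, f(1)] on [t, t^2, t^3, t^4]. *)
Definition line_dual (i : 'I_4) : {poly R} := nth 0
  [:: comb4 60 2 (-10) 15 (-7) 1 2 3 4;
      comb4 60 (-8) 45 (-72) 35 1 2 3 4;
      comb4 420 1 (-6) 10 (-5) 1 2 3 4;
      comb4 1 (-4) 30 (-60) 35 1 2 3 4] i.

Lemma dual_line : dual_system 'X line_dual.
Proof.
move=> i; elim/ord4_ind: i; rewrite /line_dual /=;
  (split; [exact: comb4_0 | rewrite pint_comb4 | rewrite -{1}['X]expr1 pint_Xn_comb4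
  | rewrite pint_Xn_comb4 | rewrite comb4_1]); by field.
Qed.

(** [hump = t^3 (1 - t)^2]: it vanishes at both ends together with its
    derivative, so that the motion starts and stops at rest at the origin.
    The symmetric choice [phi = t^2 (1 - t)^2] would fail on
    [t, t^2, t^3, t^4]: the moments against 1, [phi], [phi^2] only see the
    part of [f] that is even about [1/2], and so does [f(1)] once
    [f(0) = 0], which leaves a space of dimension 3. *)
Definition hump : {poly R} := 'X^3 - 2 *: 'X^4 + 'X^5.

(** The inverse matrix is taken here on [t, t^2, t^4, t^5], on which its
    entries are simpler than on [t, t^2, t^3, t^4]. *)
Definition hump_dual (i : 'I_4) : {poly R} := nth 0
  [:: comb4 (15 / 2) 24 (-9) (-191) 176 1 2 4 5;
      comb4 (63 * 110) (-4) (-1) 45 (-40) 1 2 4 5;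
      comb4 (360 * 1001) 2 1 (-25) 22 1 2 4 5;
      comb4 4^-1 (-28) 35 85 (-88) 1 2 4 5] i.

Lemma pint_hump_mul f : pint (hump * f) =
  pint ('X^3 * f) - 2 * pint ('X^4 * f) + pint ('X^5 * f).
Proof.
have -> : hump * f = 'X^3 * f + (- 2) *: ('X^4 * f) + 'X^5 * f.
  by rewrite /hump -!mul_polyC polyCN !rmorph_nat; ring.
by rewrite !(pintD, pintZ); ring.
Qed.

Lemma pint_sqr_hump_mul f : pint (hump ^+ 2 * f) =
  pint ('X^6 * f) - 4 * pint ('X^7 * f) + 6 * pint ('X^8 * f)
  - 4 * pint ('X^9 * f) + pint ('X^10 * f).
Proof.
have -> : hump ^+ 2 * f = 'X^6 * f + (- 4) *: ('X^7 * f) + 6 *: ('X^8 * f)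
    + (- 4) *: ('X^9 * f) + 'X^10 * f.
  by rewrite /hump -!mul_polyC !polyCN !rmorph_nat; ring.
by rewrite !(pintD, pintZ); ring.
Qed.

Lemma dual_hump : dual_system hump hump_dual.
Proof.
move=> i; elim/ord4_ind: i; rewrite /hump_dual /=;
  (split; [exact: comb4_0 | rewrite pint_comb4
  | rewrite pint_hump_mul !pint_Xn_comb4
  | rewrite pint_sqr_hump_mul !pint_Xn_comb4 | rewrite comb4_1]); by field.
Qed.

End dual_systems.

(** * Pliable vectors *)

Section pliability.
Context {R : realType}.
Implicit Types (a b : R) (x v : {poly R}) (t : R).

Lemma hlayer_combE a b : a *: X1 R + b *: X2 R = row2 a b.
Proof.
apply/rowP => -[[|[|//]] hi]; rewrite !mxE /=.
  by rewrite mulr1 mulr0 addr0.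
by rewrite mulr1 mulr0 add0r.
Qed.

(** The conclusion of [endpoint_cover] at the final state of [exp(tV)],
    [V = a X_1 + b X_2], for controls arbitrarily close to [(a, b)]. *)
Definition controllable a b : Prop := forall eta : R, 0 < eta ->
  \forall z \near ((row4 a b (a * b / 2) (a ^+ 2 * b / 6), row2 a b)
                   : 'rV[R]_4 * 'rV[R]_2),
  exists x v, [/\ x.[0] = 0, x^`().[0] = a, v.[0] = b,
    z = (pcurve x v 1, row2 x^`().[1] v.[1]) &
    forall t, 0 <= t <= 1 -> `|x^`().[t] - a| <= eta /\ `|v.[t] - b| <= eta].

Lemma pintX : pint ('X : {poly R}) = 2^-1.
Proof. by rewrite -['X]expr1 pintXn. Qed.

Lemma controllable_neq0 a b : a != 0 -> controllable a b.
Proof.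
move=> a0 eta eta0.
have X'1 t : (('X : {poly R})^`()).[t] = 1 by rewrite derivX hornerC.
have := endpoint_cover b dual_line a0 eta0 (hornerX 0).
rewrite X'1 mulr1 hornerX mulr1 pintX pintXn => /(_ a erefl).
have -> : row4 a b (b * (a / 2)) (b * (a ^+ 2 / 2 / 3)) =
    row4 a b (a * b / 2) (a ^+ 2 * b / 6).
  by congr row4; field.
by rewrite X'1 mulr1; apply=> t _; rewrite X'1 mulr1 subrr normr0 divr_ge0// ltW.
Qed.

(** The reference [s * hump] returns to the origin at rest, and its speed is
    at most [eta / 2] for the chosen [s]. *)
Lemma controllable0 : controllable 0 0.
Proof.
move=> eta eta0.
pose M : R := 1 + coef_norm (hump : {poly R})^`().
have M0 : 0 < M by rewrite ltr_pwDl// coef_norm_ge0.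
pose s := eta / 2 / M.
have s0 : 0 < s by rewrite !divr_gt0.
have b'E t : (hump^`() : {poly R}).[t] = 3 * t ^+ 2 - 8 * t ^+ 3 + 5 * t ^+ 4.
  by rewrite /hump !poly.derivE !hornerE /=; ring.
have bE t : (hump : {poly R}).[t] = t ^+ 3 - 2 * t ^+ 4 + t ^+ 5.
  by rewrite /hump !hornerE.
have b0 : (hump : {poly R}).[0] = 0 by rewrite bE; ring.
have := endpoint_cover 0 dual_hump (lt0r_neq0 s0) eta0 b0.
move=> /(_ 0).
have -> : s * (hump^`() : {poly R}).[1] = 0 by rewrite b'E; ring.
have -> : s * (hump : {poly R}).[1] = 0 by rewrite bE; ring.
rewrite !mul0r mulr0 mul0r; apply; first by rewrite b'E; ring.
move=> t t01; rewrite subr0 normrM (gtr0_norm s0) /s mulrAC ler_pdivrMr//.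
rewrite ler_wpM2l ?divr_ge0 ?(ltW eta0)//.
by rewrite (le_trans (horner_le_coef_norm _ t01))// lerDr.
Qed.

Lemma engel_mul_polycurve (y : engel R) p q r s t :
  engel_mul y (polycurve p q r s t) =
  polycurve ((y 0 0)%:P + p) ((y 0 1)%:P + q) ((y 0 2)%:P + r + y 0 0 *: q)
    ((y 0 3)%:P + s + y 0 0 *: r + (y 0 0 ^+ 2 / 2) *: q) t.
Proof.
by rewrite /engel_mul /polycurve !row4E !(hornerD, hornerZ, hornerC).
Qed.

(** Left translations preserve the horizontal fields. *)
Lemma horizontal_translate (k0 k1 k2 k3 : R) p q r s :
  horizontal_poly p q r s ->
  horizontal_poly (k0%:P + p) (k1%:P + q) (k2%:P + r + k0 *: q)
    (k3%:P + s + k0 *: r + (k0 ^+ 2 / 2) *: q).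
Proof.
move=> [rE sE]; split; rewrite !(derivD, derivC, derivZ) !add0r rE ?sE.
  by rewrite -mul_polyC; ring.
have -> : k0 *: (p * q^`()) = (2 * 2^-1 * k0) *: (p * q^`()).
  by congr (_ *: _); field.
by move: (2^-1 : R) => h; rewrite -!mul_polyC; ring.
Qed.

(** Points near the origin are end points of horizontal curves of small speed
    by [controllable0], and left translations preserve length; hence the
    radius [d] does not depend on [y]. *)
Lemma cc_dist_small (e : R) : 0 < e -> exists2 d : R, 0 < d &
  forall y z : engel R, (forall i, `|z 0 i| <= d) ->
    (cc_dist y (engel_mul y z) <= e%:E)%E.
Proof.
move=> e0; have e2 : 0 < e / 2 by exact: divr_gt0.
have := controllable0 e2.
rewrite !(mul0r, mulr0); have -> : row4 0 0 0 0 = 0 :> 'rV[R]_4.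
  by apply: row4P; rewrite !mxE.
have -> : row2 0 0 = 0 :> 'rV[R]_2.
  by apply/rowP => -[[|[|//]] hi]; rewrite !mxE.
move=> [[A B] /= [A0 B0] AB].
have /nbhs_ballP[d /= d0 dA] := A0.
exists (d / 2); first exact: divr_gt0.
move=> y z zd.
have Az : A z.
  apply: dA; rewrite -ball_normE /ball_ /= sub0r normrN.
  apply: le_lt_trans (row4_norm_le zd) _; lra.
have [x [v [x0 _ _ [zE _] xv]]] := AB (z, 0) (conj Az (nbhs_singleton B0)).
have y0 : y = engel_mul y (pcurve x v 0).
  by rewrite pcurve0// /engel_mul; apply: row4P; rewrite !mxE /=; ring.
rewrite zE {1}y0 /pcurve !engel_mul_polycurve (_ : e = 2 * (e / 2)); last by field.
apply: cc_dist_polycurve; first exact/horizontal_translate/horizontal_pcurve.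
move=> t /xv[]; rewrite !subr0 !(derivD, derivC) !add0r deriv_prim.
by [].
Qed.

Lemma exp_curveE a b t : engel_exp (t *: hlayer_incl (row2 a b)) =
  polycurve (a *: 'X) (b *: 'X) ((a * b / 2) *: 'X^2) ((a ^+ 2 * b / 6) *: 'X^3) t.
Proof.
rewrite /engel_exp /polycurve !mxE /= !(hornerZ, hornerX, hornerXn).
by congr row4; field.
Qed.

Lemma horizontal_exp a b : horizontal_poly (a *: 'X) (b *: 'X)
  ((a * b / 2) *: 'X^2) ((a ^+ 2 * b / 6) *: 'X^3).
Proof.
have c2 : (a * b / 2) * 2 = a * b by field.
have c3 : (a ^+ 2 * b / 6) * 3 = 2^-1 * (a ^+ 2 * b) by field.
have scaler_mulrn (k : R) (p : {poly R}) n : k *: (p *+ n) = (k * n%:R) *: p.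
  by rewrite -scaler_nat scalerA.
split; rewrite !derivZ !derivXn derivX.
  by rewrite scaler_mulrn c2 -!mul_polyC; ring.
rewrite scaler_mulrn c3.
by move: (2^-1 : R) => h; rewrite -!mul_polyC; ring.
Qed.

(** With [sigma = pcurve x v], the element [z = exp(tV)^-1 * sigma(t)] moves
    by the left-invariant fields with controls [(x', v)] and by the
    right-invariant ones with controls [(-a, -b)]: [z_1' = x' - a],
    [z_2' = v - b], [z_3' = z_1 v - a z_2] and [z_4' = z_1^2 / 2 v - a z_3].
    The first two right-hand sides are at most [eta], and each of the others
    is small because the previous [z_i] are. *)
Lemma exp_pcurve_close a b (eta : R) x v t : eta <= 1 -> x.[0] = 0 ->
  (forall r, 0 <= r <= 1 -> `|x^`().[r] - a| <= eta /\ `|v.[r] - b| <= eta) ->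
  0 <= t <= 1 ->
  exists2 z, pcurve x v t = engel_mul (engel_exp (t *: hlayer_incl (row2 a b))) z &
    forall i, `|z 0 i| <= 2 * (1 + `|a| + `|b|) ^+ 2 * eta.
Proof.
move=> eta1 x0 xv t01; set K := 1 + _ + _.
have eta0 : 0 <= eta.
  by apply: le_trans (xv t t01).1.
have K1 : 1 <= K by rewrite /K -addrA lerDl addr_ge0.
have K2 : K <= K ^+ 2 by rewrite expr2 ler_peMl// (le_trans ler01).
have Keta : K * eta <= K ^+ 2 * eta by exact: ler_wpM2r.
have etaK : eta <= K * eta by exact: ler_peMl.
pose z1 := x - a *: 'X.
pose z2 := prim v - b *: 'X.
pose z3 := prim (x * v) - (a * b / 2) *: 'X^2 - a *: ('X * z2).
pose z4 := prim (2^-1 *: (x ^+ 2 * v)) - (a ^+ 2 * b / 6) *: 'X^3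
  - a *: ('X * z3) - (a ^+ 2 / 2) *: ('X^2 * z2).
have z1' r : z1^`().[r] = x^`().[r] - a.
  by rewrite /z1 derivB derivZ derivX !(hornerE, hornerD, hornerZ, hornerC).
have z2' r : z2^`().[r] = v.[r] - b.
  by rewrite /z2 derivB derivZ derivX deriv_prim !hornerE.
have z3' r : z3^`().[r] = z1.[r] * v.[r] - a * z2.[r].
  clearbody z2; rewrite /z3 !(derivB, derivZ, derivM, derivX, derivXn) deriv_prim.
  rewrite !(hornerN, hornerD, hornerZ, hornerM, hornerC, hornerX, hornerXn).
  rewrite ?hornerMn z2'.
  by rewrite /z1 !hornerE /=; field.
have z4' r : z4^`().[r] = z1.[r] ^+ 2 / 2 * v.[r] - a * z3.[r].
  clearbody z3 z2; rewrite /z4 !(derivB, derivZ, derivM, derivX, derivXn) deriv_prim.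
  rewrite !(hornerN, hornerD, hornerZ, hornerM, hornerC, hornerX, hornerXn).
  rewrite ?hornerMn z2' z3'.
  by rewrite /z1 !hornerE /=; field.
have vK r : 0 <= r <= 1 -> `|v.[r]| <= 1 + `|b|.
  move=> r01; rewrite -(subrK b v.[r]) (le_trans (ler_normD _ _))// lerD//.
  exact: le_trans (xv r r01).2 eta1.
have z1e r : 0 <= r <= 1 -> `|z1.[r]| <= eta.
  apply: horner_le_deriv => [|u /xv[]]; last by rewrite z1'.
  by rewrite /z1 !hornerE x0 /=; ring.
have z20 : z2.[0] = 0 by rewrite /z2 hornerD prim0 !hornerE /=; ring.
have z30 : z3.[0] = 0.
  by rewrite /z3 !(hornerD, hornerN) prim0 !hornerE /=; ring.
have z40 : z4.[0] = 0.
  by rewrite /z4 !(hornerD, hornerN) prim0 !hornerE /=; ring.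
have z2e r : 0 <= r <= 1 -> `|z2.[r]| <= eta.
  by apply: horner_le_deriv => // u /xv[]; rewrite z2'.
have z3e r : 0 <= r <= 1 -> `|z3.[r]| <= K * eta.
  apply: horner_le_deriv => // u u01; rewrite z3' (le_trans (ler_normB _ _))//.
  have -> : K * eta = eta * (1 + `|b|) + `|a| * eta by rewrite /K; ring.
  by rewrite !normrM lerD// ?ler_wpM2l ?z2e// ler_pM ?vK ?z1e.
have z4e r : 0 <= r <= 1 -> `|z4.[r]| <= 2 * K ^+ 2 * eta.
  apply: horner_le_deriv => // u u01; rewrite z4' (le_trans (ler_normB _ _))//.
  have -> : 2 * K ^+ 2 * eta = eta * K ^+ 2 + K * (K * eta) by ring.
  rewrite !normrM lerD//; last first.
    by rewrite ler_pM ?z3e// /K; have := normr_ge0 b; lra.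
  apply: (@le_trans _ _ (eta * (1 + `|b|))); last first.
    rewrite ler_wpM2l// (le_trans _ K2)// /K; have := normr_ge0 a; lra.
  rewrite ler_pM ?vK// normfV (ger0_norm (ler0n _ 2)).
  have := z1e u u01; have := normr_ge0 z1.[u] => w0 w1.
  have : `|z1.[u]| * `|z1.[u]| <= eta * 1 by rewrite ler_pM// (le_trans w1).
  by lra.
exists (row4 z1.[t] z2.[t] z3.[t] z4.[t]).
  rewrite exp_curveE /pcurve /polycurve /engel_mul !row4E.
  rewrite /z4 /z3 /z2 /z1.
  rewrite !(hornerN, hornerD, hornerZ, hornerM, hornerC, hornerX, hornerXn).
  by congr row4; field.
have := z1e t t01; have := z2e t t01; have := z3e t t01; have := z4e t t01.
have KK : K ^+ 2 * eta <= 2 * K ^+ 2 * eta.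
  by rewrite -mulrA ler_peMl ?ler1n// mulr_ge0// sqr_ge0.
by move=> h4 h3 h2 h1 i; elim/ord4_ind: i; rewrite row4E; lra.
Qed.

Lemma C1H_dist_le (g1 g2 : R -> engel R) (e : R) :
  (forall t, 0 <= t <= 1 -> (cc_dist (g1 t) (g2 t) <= e%:E)%E) ->
  (forall t, 0 <= t <= 1 -> hnorm (hderive 0 1 g2 t - hderive 0 1 g1 t) <= e) ->
  (C1H_dist 0 1 g1 g2 <= e%:E)%E.
Proof.
move=> ge he; rewrite /C1H_dist ge_max; apply/andP; split.
  by apply: ge_ereal_sup => _ [t /= + <-]; rewrite in_itv /=; exact: ge.
by apply: ge_ereal_sup => _ [t /= + <-]; rewrite in_itv /= lee_fin; exact: he.
Qed.

Lemma pliable_controllable a b : controllable a b -> pliable_vector (row2 a b).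
Proof.
move=> ctrl; rewrite /pliable_vector.
have -> : (fun t => engel_exp (t *: hlayer_incl (row2 a b))) = polycurve
    (a *: 'X) (b *: 'X) ((a * b / 2) *: 'X^2) ((a ^+ 2 * b / 6) *: 'X^3).
  by apply/funext => t; rewrite exp_curveE.
set g := polycurve _ _ _ _.
have i0 : `[0, 1]%classic (0 : R) by rewrite /= in_itv /= lexx ler01.
have i1 : `[0, 1]%classic (1 : R) by rewrite /= in_itv /= lexx ler01.
have g' t : `[0, 1]%classic t -> hderive 0 1 g t = row2 a b.
  move=> t01; rewrite hderive_polycurve// !derivZ derivX !hornerE.
  by congr row2; ring.
split; first exact/C1H_polycurve/horizontal_exp.
move=> V [VC [e e0 eV]].
have e2 : 0 < e / 2 by exact: divr_gt0.
have [d d0 dP] := cc_dist_small e2.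
pose K := 2 * (1 + `|a| + `|b|) ^+ 2.
have K0 : 0 < K by rewrite mulr_gt0// exprn_gt0// -addrA ltr_pwDl// addr_ge0.
(* [e / 4] is for the directions, as [hnorm_le] loses a factor 2, and [d / K]
   for the positions. *)
pose eta := Num.min 1 (Num.min (e / 4) (d / K)).
have eta0 : 0 < eta by rewrite !lt_min ltr01 !divr_gt0.
have eta1 : eta <= 1 by rewrite ge_min lexx.
have etae : eta <= e / 4 by rewrite !ge_min lexx !orbT.
have etad : K * eta <= d by rewrite mulrC -ler_pdivlMr// !ge_min lexx !orbT.
have := ctrl eta eta0; rewrite g'//.
have -> : g 1 = row4 a b (a * b / 2) (a ^+ 2 * b / 6).
  by rewrite /g /polycurve !(hornerZ, hornerX, hornerXn) !expr1n !mulr1.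
apply: filterS => z [x [v [x0 x'0 v0 zE xv]]].
have s' t : `[0, 1]%classic t -> hderive 0 1 (pcurve x v) t = row2 x^`().[t] v.[t].
  by move=> t01; rewrite hderive_polycurve// deriv_prim.
exists (pcurve x v); last by rewrite s'// zE.
split; last first.
  rewrite s'// g'// x'0 v0 pcurve0//; congr pair.
  rewrite /g /polycurve !(hornerZ, hornerX, hornerXn) !expr0n /= !mulr0.
  by apply: row4P; rewrite !mxE.
apply: eV; split; first exact/C1H_polycurve/horizontal_pcurve.
apply: (@le_lt_trans _ _ (e / 2)%:E); last by rewrite lte_fin; lra.
apply: C1H_dist_le => t t01.
  have [z' -> z'd] := exp_pcurve_close eta1 x0 xv t01.
  rewrite /g -exp_curveE; apply: dP => i; exact: le_trans (z'd i) etad.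
have [xe ve] := xv t t01.
have tt : `[0, 1]%classic t by rewrite /= in_itv.
rewrite s'// g'//.
have -> : row2 x^`().[t] v.[t] - row2 a b = row2 (x^`().[t] - a) (v.[t] - b).
  by apply/rowP => -[[|[|//]] hi]; rewrite !mxE.
by apply: le_trans (hnorm_le xe ve) _; lra.
Qed.

End pliability.

(** * Rigidity in the direction [X_2] *)

Section singular_direction.
Context {R : realType}.
Implicit Types (g : R -> engel R) (u : R -> hlayer R) (t b : R).

Lemma is_derive_coord g t (l : 'rV[R]_4) i :
  is_derive t 1 (g : R -> 'rV[R]_4) l -> is_derive t 1 (fun s => g s 0 i : R) (l 0 i).
Proof.
move=> [gd gl]; apply: DeriveDef; first exact: (derivable_mxP _ _ _).1 gd 0 i.
by rewrite -gl derive_mx// mxE.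
Qed.

(** Absolute continuity for a single interval. *)
Lemma abs_cont_continuous g i : abs_cont 0 1 g ->
  {within `[0, 1]%classic, continuous (fun t => g t 0 i : R)}.
Proof.
move=> gac; apply/subspace_continuousP => t; rewrite /= in_itv /= => /andP[t0 t1].
apply/cvgrPdist_lt => e e0; have [d d0 dP] := gac e e0.
have close s r : 0 <= s -> s <= r -> r <= 1 -> r - s < d ->
    `|g r 0 i - g s 0 i| < e.
  move=> s0 sr r1 rsd.
  have := dP 1 (fun=> s) (fun=> r) (fun=> conj s0 (conj sr r1)).
  rewrite !big_ord1 => H; apply: le_lt_trans (H _ rsd); last first.
    by move=> [[|//] ?] [[|//] ?] /eqP[]; exact: val_inj.
  rewrite /Num.Def.normr /= mx_normrE.
  have := le_bigmax (0 : R) (fun ij : 'I_1 * 'I_4 =>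
    `|((g r : 'rV[R]_4) - g s) ij.1 ij.2|) (0, i).
  by rewrite /= !mxE.
suff : \forall s \near t, `[0, 1]%classic s -> `|g t 0 i - g s 0 i| < e by [].
apply: filterS (nbhsx_ballx t d d0) => s st; rewrite /= in_itv /= => /andP[s0 s1].
rewrite /ball /= in st.
have [ts|st'] := leP t s.
  by rewrite distrC close//; rewrite distrC ger0_norm ?subr_ge0// in st.
by rewrite close ?(ltW st')//; rewrite ger0_norm ?subr_ge0 ?(ltW st') in st.
Qed.

(** Almost everywhere [x_4' = x_1^2 / 2 * x_2'].  If [b x_4'] were negative at
    an interior point, it would be so on a ball by continuity of the
    derivative, and that ball would be contained in a null set. *)
Lemma derive_on_contact g u : C1 0 1 g -> horizontal 0 1 g u -> forall b,
  (forall t, `[0, 1]%classic t -> 0 < b * derive_on 0 1 g t 0 1) ->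
  forall t, `]0, 1[%classic t -> 0 <= b * derive_on 0 1 g t 0 3.
Proof.
move=> [gd gc] [_ _ [N [mN N0 NP]]] b bg t t01; rewrite leNgt; apply/negP => neg.
have Dc : {for t, continuous (fun s => b * derive_on 0 1 g s 0 3)}.
  have : {in `]0, 1[%classic, continuous (derive_on 0 1 g)}.
    rewrite -continuous_open_subspace; last exact: interval_open.
    by apply: continuous_subspaceW gc; exact: subset_itv_oo_cc.
  move=> /(_ t); rewrite inE => /(_ t01) Dt.
  apply: cvgM; first exact: cvg_cst.
  by apply: (@cvg_comp _ _ _ _ (fun m : 'rV[R]_4 => m 0 3) _ _ _ Dt);
    exact: coord_continuous.
have : \forall s \near t, `]0, 1[%classic s /\ b * derive_on 0 1 g s 0 3 < 0.
  near=> s; split; last by near: s; apply: cvgr_lt neg; exact: Dc.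
  by near: s; apply: open_nbhs_nbhs; split => //; exact: interval_open.
move=> /nbhs_ballP[r /= r0 rP].
have BN : ball t r `<=` N.
  move=> s /rP[s01 sneg]; apply: NP => /= H.
  have s01' : `[0, 1]%classic s by exact: subset_itv_oo_cc.
  have sE : derive_on 0 1 g s = hfield (u s) (g s).
    have h1 := is_derive_derive_on s01 (gd s s01').
    have h2 := H s01'.
    by rewrite -(@derive_val _ _ _ _ _ _ _ h1) -(@derive_val _ _ _ _ _ _ _ h2).
  move: sneg (bg s s01'); rewrite sE /hfield !mxE /= !(mulr0, mulr1, add0r).
  have := sqr_ge0 (g s 0 0); nra.
have : (lebesgue_measure (ball t r) <= lebesgue_measure N)%E.
  by apply: le_measure => //; rewrite ?inE//; exact: measurable_ball.
by rewrite N0 (lebesgue_measure_ball _ (ltW r0)) lee_fin leNgt mulrn_wgt0.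
Unshelve. all: by end_near. Qed.

Lemma contact_monotone g b : C1H 0 1 g ->
  (forall t, `[0, 1]%classic t -> 0 < b * derive_on 0 1 g t 0 1) ->
  b * g 0 0 3 <= b * g 1 0 3.
Proof.
move=> [gC [u gu]] bg.
have D t : t \in `]0, 1[ -> is_derive t 1 (fun s => b * g s 0 3 : R)
    (b * derive_on 0 1 g t 0 3).
  move=> t01; have t01' : `[0, 1]%classic t by exact: subset_itv_oo_cc.
  have := is_derive_coord 3 (is_derive_derive_on t01 (gC.1 t t01')).
  by move=> h; exact: (@is_deriveZ _ _ _ _ b _ _ _ h).
apply: (@ger0_derive1_le_cc R (fun s => b * g s 0 3) 0 1) => //.
- by move=> t /D[].
- move=> t t01; rewrite derive1E (@derive_val _ _ _ _ _ _ _ (D t t01)).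
  exact: derive_on_contact gC gu b bg t t01.
- have [gac _ _] := gu.
  move=> t; apply: cvgM; first exact: cvg_cst.
  exact: abs_cont_continuous.
- by rewrite in_itv /= lexx ler01.
- by rewrite in_itv /= lexx ler01.
Qed.

(** Take the ball of radius [|b|] around [exp(tV)]: there [x_2'] keeps the
    sign of [b], while the targets [(0, b, 0, d)] with [b d < 0] are
    arbitrarily close to [exp V]. *)
Lemma not_pliable_vertical b : b != 0 -> ~ pliable_vector (row2 0 b).
Proof.
move=> b0; rewrite /pliable_vector; set g := (X in pliable _ _ X); move=> [_].
have gE : g = polycurve (0 *: 'X) (b *: 'X) ((0 * b / 2) *: 'X^2)
    ((0 ^+ 2 * b / 6) *: 'X^3).
  by apply/funext => t; rewrite /g exp_curveE.
have g' t : `[0, 1]%classic t -> hderive 0 1 g t = row2 0 b.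
  move=> t01; rewrite gE hderive_polycurve// !derivZ derivX !hornerE.
  by congr row2; ring.
have i1 : `[0, 1]%classic (1 : R) by rewrite /= in_itv /= lexx ler01.
pose V := [set s | C1H 0 1 s /\ (C1H_dist 0 1 g s < `|b|%:E)%E].
move=> /(_ V)[]; first by split; [move=> s []|exists `|b|; rewrite ?normr_gt0].
rewrite g'//; have -> : g 1 = row4 0 b 0 0.
  rewrite gE /polycurve !(hornerZ, hornerX, hornerXn).
  by congr row4; ring.
move=> [A B] /= [A0 B0] AB.
have : \forall d \near (0 : R), A (row4 0 b 0 d).
  have cd : (fun d : R => row4 0 b 0 d : 'rV[R]_4) =
      polycurve 0 b%:P 0 'X.
    by apply/funext => d; rewrite /polycurve hornerX !hornerC.
  have := @continuous_polycurve R 0 b%:P 0 'X 0.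
  by rewrite -cd; apply.
move=> /nbhs_ballP[e /= e0 eA].
pose d := - (Num.sg b * (e / 2)).
have Ad : A (row4 0 b 0 d).
  apply: eA; rewrite -ball_normE /ball_ /= sub0r normrN /d normrN normrM.
  by rewrite normr_sg b0 mul1r gtr0_norm ?divr_gt0//; lra.
have [s [[sC sd] s0] s1] := AB (row4 0 b 0 d, row2 0 b)
  (conj Ad (nbhs_singleton B0)).
have bd : b * d < 0.
  by rewrite /d mulrN mulrA [b * _]mulrC -normrEsg oppr_lt0 mulr_gt0 ?normr_gt0 ?divr_gt0.
case: s1 => s1 _; case: s0 => s0 _.
have : b * s 0 0 3 <= b * s 1 0 3.
  apply: contact_monotone => // t t01.
  have : (((hnorm (hderive 0 1 s t - hderive 0 1 g t))%:E : \bar R) < `|b|%:E)%E.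
    apply: le_lt_trans sd; rewrite /C1H_dist le_max; apply/orP; right.
    by apply: ereal_sup_ubound; exists t.
  rewrite lte_fin g'// /hnorm !mxE /= => H.
  have : Num.sqrt ((derive_on 0 1 s t 0 1 - b) ^+ 2) < `|b|.
    apply: le_lt_trans H; rewrite ler_sqrt ?addr_ge0 ?sqr_ge0//.
    by rewrite lerDr sqr_ge0.
  rewrite sqrtr_sqr; move: (derive_on 0 1 s t 0 1) => y.
  have [b_gt0|b_lt0|b_eq0] := ltgtP 0 b; last by rewrite b_eq0 eqxx in b0.
    rewrite (gtr0_norm b_gt0) ltr_norml => /andP[? _].
    by rewrite mulr_gt0//; lra.
  rewrite (ltr0_norm b_lt0) ltr_norml => /andP[_ ?].
  by rewrite nmulr_rgt0//; lra.
have -> : s 0 0 3 = 0.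
  by rewrite s0 gE /polycurve row4E hornerZ hornerXn; ring.
rewrite s1 row4E mulr0.
by rewrite leNgt bd.
Qed.

End singular_direction.

Theorem theorem4p1 (R : realType) (a b : R) :
  pliable_vector (a *: X1 R + b *: X2 R) <-> a <> 0 \/ (a = 0 /\ b = 0).
Proof.
rewrite hlayer_combE; split.
  have [-> pl|/eqP a0 _] := eqVneq a 0; last by left.
  right; split=> //; apply/eqP; apply/negPn/negP => b0.
  exact: not_pliable_vertical b0 pl.
move=> [/eqP a0|[-> ->]]; apply: pliable_controllable.
  exact: controllable_neq0.
exact: controllable0.
Qed.
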